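(* For any Ricci soliton $(M^n,g,V,\lambda)$ with scalar curvature $S$ and energy function $E=\frac12 g(V,V)$, $$\operatorname{div}\left(\nabla S+\nabla E+\nabla_V V-\lambda V\right)=0.$$
   Context: A Ricci soliton is a quadruple $(M^n,g,V,\lambda)$ where $(M^n,g)$ is a complete $n$-dimensional Riemannian manifold, $V$ is a complete (smooth) vector field on $M$, and $\lambda\in\mathbb{R}$, satisfying $\frac12\mathcal{L}_V g+\mathrm{Ric}=\frac{\lambda}{2}g$, where $\mathcal{L}_V$ is the Lie derivative along $V$ and $\mathrm{Ric}$ is the Ricci tensor of $(M,g)$. *)

(* Defs.v *)
From HB Require Import structures.
From mathcomp Require Import all_boot all_order all_algebra.
From mathcomp Require Import all_classical all_reals all_analysis.

Set Implicit Arguments.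
Unset Strict Implicit.
Unset Printing Implicit Defensive.

Import Order.TTheory GRing.Theory Num.Theory.
Import numFieldNormedType.Exports.

Local Open Scope classical_set_scope.
Local Open Scope ring_scope.

(** Riemannian geometry in local coordinates.  A tensor field is given, as in
    the classical definition, by its components in every chart of the atlas,
    subject to the tensor transformation rule under changes of charts. *)

Section Smooth.
Context {R : realType} {n : nat}.
Implicit Types (i : 'I_n) (f : 'rV[R]_n -> R).

Definition partial i f : 'rV[R]_n -> R :=
  fun x => 'D_(delta_mx 0 i) f x.

(** C^oo on [U], for [U] open: all iterated partial derivatives exist and are
    (Frechet) differentiable, hence continuous, at every point of [U]. *)
Definition smooth_on (U : set 'rV[R]_n) f :=
  forall (s : seq 'I_n) (x : 'rV[R]_n),
    U x -> differentiable (foldr partial f s) x.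

End Smooth.

Section Manifold.
Variables (R : realType) (n : nat).

(** [chart_map] is only meaningful on [chart_dom], and [chart_inv] on the
    image of [chart_dom] under [chart_map]. *)
Record chart (M : topologicalType) := Chart {
  chart_dom : set M ;
  chart_map :> M -> 'rV[R]_n ;
  chart_inv : 'rV[R]_n -> M ;
  chart_dom_open : open chart_dom ;
  chart_cod_open : open (chart_map @` chart_dom) ;
  chart_mapK : forall p, chart_dom p -> chart_inv (chart_map p) = p ;
  chart_map_continuous : {within chart_dom, continuous chart_map} ;
  chart_inv_continuous :
    {within chart_map @` chart_dom, continuous chart_inv}
}.

Definition chart_cod (M : topologicalType) (c : chart M) : set 'rV[R]_n :=
  c @` chart_dom c.

Definition transition (M : topologicalType) (c c' : chart M) :
  'rV[R]_n -> 'rV[R]_n := fun x => c' (chart_inv c x).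

Definition transition_dom (M : topologicalType) (c c' : chart M) :
  set 'rV[R]_n := c @` (chart_dom c `&` chart_dom c').

(** The smooth structure is the one generated by [atlas], which need not be
    maximal. *)
Record smoothManifold := SmoothManifold {
  carrier :> topologicalType ;
  manifold_hausdorff : hausdorff_space carrier ;
  manifold_second_countable : @second_countable carrier ;
  atlas : set (chart carrier) ;
  atlas_cover : forall p : carrier, exists2 c, atlas c & chart_dom c p ;
  atlas_smooth : forall c c', atlas c -> atlas c' -> forall k : 'I_n,
    smooth_on (transition_dom c c') (fun x => transition c c' x 0 k)
}.

End Manifold.

Section RiemannianGeometry.
Context {R : realType} {n : nat} {M : smoothManifold R n}.

Local Notation point := 'rV[R]_n.
Local Notation chart := (chart R n M).

Definition chart_at (p : M) : chart := sval (cid2 (atlas_cover p)).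

(** Contravariant components [X^k], as functions of the chart and of the
    coordinates. *)
Definition components := chart -> point -> 'rV[R]_n.

Record vectorField := VectorField {
  vf_comp :> chart -> point -> 'rV[R]_n ;
  vf_smooth : forall c, atlas c -> forall k : 'I_n,
    smooth_on (chart_cod c) (fun x => vf_comp c x 0 k) ;
  vf_compat : forall c c', atlas c -> atlas c' ->
    forall x, transition_dom c c' x ->
    vf_comp c' (transition c c' x) = 'd (transition c c') x (vf_comp c x)
}.

Record riemannianMetric := RiemannianMetric {
  metric :> chart -> point -> 'M[R]_n ;
  metric_smooth : forall c, atlas c -> forall i j : 'I_n,
    smooth_on (chart_cod c) (fun x => metric c x i j) ;
  metric_compat : forall c c', atlas c -> atlas c' ->
    forall x, transition_dom c c' x -> forall u v : 'rV[R]_n,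
    u *m metric c x *m v^T
      = 'd (transition c c') x u *m metric c' (transition c c' x)
          *m ('d (transition c c') x v)^T ;
  metric_sym : forall c, atlas c -> forall x, chart_cod c x ->
    (metric c x)^T = metric c x ;
  metric_posdef : forall c, atlas c -> forall x, chart_cod c x ->
    forall u : 'rV[R]_n, u != 0 -> 0 < (u *m metric c x *m u^T) 0 0
}.

Variable g : riemannianMetric.
Implicit Types (c : chart) (x : point) (i j k l : 'I_n) (X Y : components).

Definition metric_inv c x : 'M[R]_n := invmx (g c x).

(** [christoffel c x k i j] is the Christoffel symbol [Gamma^k_{ij}] of the
    Levi-Civita connection. *)
Definition christoffel c x k i j : R :=
  2^-1 * \sum_l metric_inv c x k l *
    (partial i (fun y => g c y j l) x
     + partial j (fun y => g c y i l) x
     - partial l (fun y => g c y i j) x).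

(** [k]-th component of the covariant derivative of [Y] along [d/dx^i]. *)
Definition cov_deriv Y c x i k : R :=
  partial i (fun y => Y c y 0 k) x
  + \sum_j christoffel c x k i j * Y c x 0 j.

Definition nabla X Y : components := fun c x =>
  \row_k \sum_i X c x 0 i * cov_deriv Y c x i k.

(** Defined by [R(d_i, d_j) d_k = \sum_l riemann c x l k i j d_l], where
    [R(X, Y) = [nabla_X, nabla_Y] - nabla_[X, Y]]. *)
Definition riemann c x l k i j : R :=
  partial i (fun y => christoffel c y l j k) x
  - partial j (fun y => christoffel c y l i k) x
  + \sum_(m < n) (christoffel c x l i m * christoffel c x m j k
                  - christoffel c x l j m * christoffel c x m i k).

(** [Ric(Y, Z)] is the trace of [X |-> R(X, Y) Z]. *)
Definition ricci c x : 'M[R]_n :=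
  \matrix_(j, k) \sum_i riemann c x i k i j.

Definition lie_metric X c x : 'M[R]_n :=
  \matrix_(i, j) \sum_k
    (X c x 0 k * partial k (fun y => g c y i j) x
     + g c x k j * partial i (fun y => X c y 0 k) x
     + g c x i k * partial j (fun y => X c y 0 k) x).

(** For components that transform as a vector field, the next three operations
    do not depend on the chart around [p]; they are evaluated in [chart_at p]. *)

Definition scalar_curvature (p : M) : R :=
  let c := chart_at p in
  \sum_i \sum_j metric_inv c (c p) i j * ricci c (c p) i j.

Definition energy X (p : M) : R :=
  let c := chart_at p in
  2^-1 * (X c (c p) *m g c (c p) *m (X c (c p))^T) 0 0.

Definition divergence X (p : M) : R :=
  let c := chart_at p in \sum_i cov_deriv X c (c p) i i.

Definition gradient (f : M -> R) : components := fun c x =>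
  \row_i \sum_j metric_inv c x i j * partial j (f \o chart_inv c) x.

Definition integral_curve X (gamma : R -> M) :=
  continuous gamma /\
  forall c, atlas c -> forall t, chart_dom c (gamma t) ->
    is_derive t (1 : R) (c \o gamma) (X c (c (gamma t))).

Definition complete_field X :=
  forall p : M, exists2 gamma : R -> M, gamma 0 = p & integral_curve X gamma.

Definition geodesic (gamma : R -> M) :=
  continuous gamma /\
  forall c, atlas c -> forall t, chart_dom c (gamma t) ->
    let x := c \o gamma in
    (\forall s \near t, derivable x s 1) /\
    is_derive t (1 : R) (derive1 x)
      (- \row_k \sum_i \sum_j
          christoffel c (x t) k i j * derive1 x t 0 i * derive1 x t 0 j).

(** Geodesic completeness: every initial velocity [v] at [p] is the velocity
    of a geodesic defined on the whole real line. *)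
Definition complete_metric :=
  forall (p : M) c (v : 'rV[R]_n), atlas c -> chart_dom c p ->
    exists gamma : R -> M,
      [/\ geodesic gamma, gamma 0 = p & is_derive (0 : R) (1 : R) (c \o gamma) v].

Definition ricci_soliton (V : vectorField) (lambda : R) :=
  [/\ complete_metric, complete_field V &
      forall c x, atlas c -> chart_cod c x ->
        2^-1 *: lie_metric V c x + ricci c x = (lambda / 2) *: g c x].

End RiemannianGeometry.

Arguments vectorField {R n} M.
Arguments riemannianMetric {R n} M.

(* Main.v *)
Require Import Defs.
From HB Require Import structures.
From mathcomp Require Import all_boot all_order all_algebra.
From mathcomp Require Import all_classical all_reals all_analysis.
From mathcomp Require Import ring lra.
Import Order.TTheory GRing.Theory Num.Theory.
Import numFieldNormedType.Exports.
Local Open Scope classical_set_scope.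
Local Open Scope ring_scope.

(** Let theta = div V.  Tracing the soliton equation gives
    S = n lambda / 2 - theta, and contracting it with V gives
    grad E + nabla_V V - lambda V = - 2 Ric(V), so the vector field W of the
    theorem is - grad theta - 2 Ric(V).  The contracted Bianchi identity and the
    commutation rule nabla_i nabla_k V^i = d_k theta + Ric(V)_k show that - W is
    the divergence of the bivector obtained by raising both indices of the
    2-form nabla_i V_j - nabla_j V_i; and the double divergence of a bivector
    vanishes.

    In one chart this is an identity in the commutative ring of smooth functions
    with its commuting partial derivatives.  As S and E are evaluated at each
    point in a chart depending on that point, they must be shown independent of
    the chart.  For S this avoids transforming the curvature: the soliton
    equation expresses Ric through g and L_V g, and that L_V g is a tensor only
    needs the symmetry of the second derivatives of the transition maps. *)

Set Implicit Arguments.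
Unset Strict Implicit.
Unset Printing Implicit Defensive.

(** * Curvature in a ring with commuting derivations *)

Section MatrixEntries.
Context {K : pzRingType} {m n : nat}.

Lemma addmxE (A B : 'M[K]_(m, n)) i j : (A + B) i j = A i j + B i j.
Proof. by rewrite mxE. Qed.

Lemma oppmxE (A : 'M[K]_(m, n)) i j : (- A) i j = - A i j.
Proof. by rewrite mxE. Qed.

Lemma zeromxE i j : (0 : 'M[K]_(m, n)) i j = 0.
Proof. by rewrite mxE. Qed.

End MatrixEntries.

Lemma trmxD {K : pzRingType} {m n : nat} (A B : 'M[K]_(m, n)) :
  (A + B)^T = A^T + B^T.
Proof. exact: linearD. Qed.

Lemma trmxN {K : pzRingType} {m n : nat} (A : 'M[K]_(m, n)) : (- A)^T = - A^T.
Proof. exact: linearN. Qed.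

(* Products of matrices become atoms once everything is expanded, so the
   commutative [ring] decides the remaining entrywise identity. *)
Ltac mx_noncomm_ring :=
  rewrite ?(mulmxDl, mulmxDr, mulmxBl, mulmxBr, mulmxN, mulNmx, mulmxA);
  let i := fresh in let j := fresh in
  apply/matrixP => i j; rewrite ?(addmxE, oppmxE, zeromxE);
  repeat match goal with
    |- context [@fun_of_matrix ?R ?m ?n ?A i j] =>
      move: (@fun_of_matrix R m n A i j) => ?
  end; ring.

Section DifferentialRing.
Variables (K : comPzRingType) (n : nat) (d : 'I_n -> {additive K -> K}).
Hypothesis dM : forall i x y, d i (x * y) = d i x * y + x * d i y.
Hypothesis dC : forall i j x, d i (d j x) = d j (d i x).
Hypothesis two_regular : forall x : K, x + x = 0 -> x = 0.

Notation D i := (map_mx (d i)).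

Lemma der_mulmx i m p q (A : 'M[K]_(m, p)) (B : 'M[K]_(p, q)) :
  D i (A *m B) = D i A *m B + A *m D i B.
Proof.
apply/matrixP => a b; rewrite !mxE raddf_sum -big_split /=.
by apply: eq_bigr => k _; rewrite dM !mxE.
Qed.

Lemma der_tr i (A : 'M[K]_n) : d i (\tr A) = \tr (D i A).
Proof. by rewrite /mxtrace raddf_sum; apply: eq_bigr => k _; rewrite mxE. Qed.

Lemma der1 i : d i 1 = 0.
Proof.
have /eqP := dM i 1 1; rewrite !(mulr1, mul1r) -subr_eq subrr => /eqP e.
by rewrite e.
Qed.

Lemma eq_oppr0 (x : K) : x = - x -> x = 0.
Proof. by move=> e; apply: two_regular; rewrite {1}e addNr. Qed.

Lemma sum_antisym (T : 'I_n -> 'I_n -> K) :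
  (forall i j, T i j = - T j i) -> \sum_i \sum_j T i j = 0.
Proof.
move=> e; apply: eq_oppr0; rewrite -sumrN exchange_big /=.
by apply: eq_bigr => i _; rewrite -sumrN; apply: eq_bigr => j _; rewrite e.
Qed.

Section LeviCivita.
Variables (G H : 'M[K]_n) (half : K).
Hypothesis G_sym : G^T = G.
Hypothesis GH : G *m H = 1%:M.
Hypothesis half_def : half + half = 1.

Definition first_kind i : 'M[K]_n :=
  \matrix_(l, j) (d i (G j l) + d j (G i l) - d l (G i j)).

Definition levi_civita i : 'M[K]_n := half *: (H *m first_kind i).

Lemma sym_entry i j : G i j = G j i.
Proof. by rewrite -[in LHS]G_sym mxE. Qed.

Lemma levi_civita_sym i j k : levi_civita i k j = levi_civita j k i.
Proof.
rewrite !mxE; congr (_ * _); apply: eq_bigr => l _; rewrite !mxE (sym_entry i j).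
by rewrite [d i _ + _]addrC.
Qed.

Lemma levi_civita_metric i :
  D i G = (levi_civita i)^T *m G + G *m levi_civita i.
Proof.
have E : G *m levi_civita i = half *: first_kind i.
  by rewrite -scalemxAr mulmxA GH mul1mx.
have -> : (levi_civita i)^T *m G = (G *m levi_civita i)^T.
  by rewrite trmx_mul G_sym.
rewrite E; apply/matrixP => a b; rewrite !mxE -[LHS]mul1r -half_def.
by rewrite (sym_entry b a); ring.
Qed.

End LeviCivita.

Variables (G H : 'M[K]_n) (Gam : 'I_n -> 'M[K]_n).
Hypothesis G_sym : G^T = G.
Hypothesis GH : G *m H = 1%:M.
Let HG : H *m G = 1%:M := mulmx1C GH.
Hypothesis Gam_sym : forall i j k, Gam i k j = Gam j k i.
Hypothesis Gam_metric : forall i, D i G = (Gam i)^T *m G + G *m Gam i.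

Lemma inv_sym : H^T = H.
Proof.
by rewrite -[LHS]mulmx1 -GH mulmxA -{1}G_sym -trmx_mul GH trmx1 mul1mx.
Qed.

Lemma der_id i : D i (1%:M : 'M[K]_n) = 0.
Proof.
apply/matrixP => a b; rewrite !mxE.
by case: (_ == _); rewrite /= ?mulr1n ?mulr0n ?der1 ?raddf0.
Qed.

Lemma der_inv i : D i H = - (H *m (Gam i)^T + Gam i *m H).
Proof.
have := der_mulmx i G H; rewrite GH der_id Gam_metric => e.
have {}e : H *m (((Gam i)^T *m G + G *m Gam i) *m H + G *m D i H) = 0.
  by rewrite -e mulmx0.
move: e; rewrite mulmxDr mulmxDl mulmxDr !mulmxA HG !mul1mx => e.
rewrite -(mulmxA _ G) GH mulmx1 in e.
by apply/eqP; rewrite -addr_eq0 addrC e.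
Qed.

(* [curv i j] is the curvature endomorphism R(d_i, d_j), so its entry (l, k) is
   R^l_{kij}; [Gam i] has entry (k, j) equal to Gamma^k_{ij}. *)
Definition curv i j : 'M[K]_n :=
  D i (Gam j) - D j (Gam i) + (Gam i *m Gam j - Gam j *m Gam i).

Lemma curv_entry i j l k : curv i j l k = d i (Gam j l k) - d j (Gam i l k)
  + \sum_m (Gam i l m * Gam j m k - Gam j l m * Gam i m k).
Proof.
rewrite /curv !addmxE !oppmxE sumrB; by congr (_ - _ + (_ - _)); rewrite mxE.
Qed.

Definition curv2 i j := curv i j *m H.

Lemma curvC i j : curv i j = - curv j i.
Proof. by rewrite /curv; mx_noncomm_ring. Qed.

Lemma curv2C i j : curv2 i j = - curv2 j i.
Proof. by rewrite /curv2 curvC mulNmx. Qed.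

Lemma derC i j p q (A : 'M[K]_(p, q)) : D i (D j A) = D j (D i A).
Proof. by apply/matrixP => a b; rewrite !mxE. Qed.

Lemma curv_skew i j : (curv i j)^T *m G + G *m curv i j = 0.
Proof.
have := derC i j G.
rewrite !Gam_metric !map_mxD !der_mulmx -!map_trmx !Gam_metric => /eqP.
rewrite -subr_eq0 => /eqP <-.
rewrite /curv !(trmxD, trmxN) !trmx_mul.
by mx_noncomm_ring.
Qed.

Lemma curv2_skew i j : (curv2 i j)^T = - curv2 i j.
Proof.
rewrite trmx_mul inv_sym; apply/eqP; rewrite -addr_eq0.
have := congr1 (fun X => H *m X *m H) (curv_skew i j).
rewrite mulmx0 mul0mx mulmxDr mulmxDl !mulmxA HG mul1mx -(mulmxA _ G) GH mulmx1.
by move=> ->.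
Qed.

Lemma bianchi2 i j k :
  D i (curv j k) + (Gam i *m curv j k - curv j k *m Gam i)
  + (D j (curv k i) + (Gam j *m curv k i - curv k i *m Gam j))
  + (D k (curv i j) + (Gam k *m curv i j - curv i j *m Gam k)) = 0.
Proof.
rewrite /curv !(map_mxD, map_mxN) !der_mulmx.
rewrite (derC j i) (derC k i) (derC k j).
by mx_noncomm_ring.
Qed.

(* The Christoffel terms of the two form indices of the curvature are left out:
   they cancel in cyclic sums. *)
Definition cder i (X : 'M[K]_n) := D i X + Gam i *m X + X *m (Gam i)^T.

Lemma cder_mulmx_inv i X :
  cder i (X *m H) = (D i X + (Gam i *m X - X *m Gam i)) *m H.
Proof. by rewrite /cder der_mulmx der_inv; mx_noncomm_ring. Qed.

Lemma bianchi2_curv2 i j k :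
  cder i (curv2 j k) + cder j (curv2 k i) + cder k (curv2 i j) = 0.
Proof.
by rewrite !cder_mulmx_inv -!mulmxDl bianchi2 mul0mx.
Qed.

Definition ric : 'M[K]_n := \matrix_(j, k) \sum_i curv i j i k.
Definition ric_sharp := ric *m H.

Lemma ric_sharpE j m : ric_sharp j m = \sum_i curv2 i j i m.
Proof.
rewrite /ric_sharp /curv2 !mxE.
rewrite (eq_bigr (fun k => \sum_i curv i j i k * H k m)); last first.
  by move=> k _; rewrite mxE mulr_suml.
by rewrite exchange_big /=; apply: eq_bigr => i _; rewrite mxE.
Qed.

Lemma curv2E i j a b : curv2 i j a b = - curv2 i j b a.
Proof.
by have /matrixP/(_ b a) := curv2_skew i j; rewrite !mxE => <-.
Qed.

Lemma curv2CE i j a b : curv2 i j a b = - curv2 j i a b.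
Proof. by rewrite curv2C oppmxE. Qed.

(* [\tr (Gam i)] is the i-th derivative of log (sqrt (det G)). *)
Definition dvg (X : 'I_n -> K) := \sum_i (d i (X i) + \tr (Gam i) * X i).

Lemma trGam i : \tr (Gam i) = \sum_j Gam j j i.
Proof. by apply: eq_bigr => j _; rewrite Gam_sym. Qed.

Lemma sum_sym_skew (S T : 'I_n -> 'I_n -> K) :
  (forall i j, S i j = S j i) -> (forall i j, T i j = - T j i) ->
  \sum_i \sum_j S i j * T i j = 0.
Proof.
by move=> Ss Tt; apply: sum_antisym => i j; rewrite Ss Tt mulrN.
Qed.

Lemma dvgE X : dvg X = \sum_i (d i (X i) + \sum_j Gam i i j * X j).
Proof.
rewrite /dvg !big_split /=; congr (_ + _).
rewrite exchange_big /=; apply: eq_bigr => i _.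
by rewrite trGam mulr_suml.
Qed.

Lemma cderE i X a b : cder i X a b =
  d i (X a b) + \sum_m Gam i a m * X m b + \sum_m X a m * Gam i b m.
Proof.
rewrite /cder !addmxE !mxE; congr (_ + _ + _).
by apply: eq_bigr => m _; rewrite mxE.
Qed.

Lemma cder_tr i X : cder i X^T = (cder i X)^T.
Proof. by rewrite /cder !linearD /= !trmx_mul !trmxK map_trmx addrAC. Qed.

Lemma bianchi_contracted k :
  dvg (ric_sharp k) + dvg (ric_sharp k)
  = d k (\tr ric_sharp) + \sum_i \sum_m Gam k i m * ric_sharp i m
      + \sum_i \sum_m Gam k i m * ric_sharp i m.
Proof.
have E1 : \sum_i \sum_j cder i (curv2 j k) i j = - dvg (ric_sharp k).
  rewrite dvgE -sumrN.
  under eq_bigr do (under eq_bigr do rewrite cderE; rewrite !big_split /=).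
  rewrite big_split /= [X in _ + X = _](_ : _ = 0) ?addr0; last first.
    rewrite exchange_big /= big1 // => j _.
    under eq_bigr do under eq_bigr do rewrite mulrC.
    apply: sum_sym_skew => [a b|a b]; first exact: Gam_sym.
    exact: curv2E.
  apply: eq_bigr => i _; rewrite opprD; congr (_ + _).
    rewrite ric_sharpE -!raddf_sum -raddfN /= -sumrN; congr (d i _).
    by apply: eq_bigr => j _; rewrite curv2E.
  rewrite exchange_big /= -sumrN; apply: eq_bigr => m _.
  rewrite ric_sharpE -mulrN -sumrN mulr_sumr; apply: eq_bigr => j _.
  by congr (_ * _); exact: curv2E.
have E2 : \sum_i \sum_j cder j (curv2 k i) i j = - dvg (ric_sharp k).
  rewrite -E1 exchange_big /=; apply: eq_bigr => i _; apply: eq_bigr => j _.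
  have -> : curv2 k j = (curv2 j k)^T by rewrite curv2_skew curv2C.
  by rewrite cder_tr mxE.
have E3 : \sum_i \sum_j cder k (curv2 i j) i j =
    d k (\tr ric_sharp) + \sum_i \sum_m Gam k i m * ric_sharp i m
      + \sum_i \sum_m Gam k i m * ric_sharp i m.
  under eq_bigr do (under eq_bigr do rewrite cderE; rewrite !big_split /=).
  rewrite !big_split /=; congr (_ + _ + _).
  - rewrite exchange_big /= raddf_sum; apply: eq_bigr => i _.
    by rewrite ric_sharpE raddf_sum.
  - apply: eq_bigr => i _; rewrite exchange_big /=; apply: eq_bigr => m _.
    rewrite ric_sharpE mulr_sumr; apply: eq_bigr => j _.
    by rewrite curv2CE curv2E opprK.
  - rewrite exchange_big /=; apply: eq_bigr => i _; rewrite exchange_big /=.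
    apply: eq_bigr => m _; rewrite ric_sharpE mulr_sumr; apply: eq_bigr => j _.
    by rewrite mulrC.
have e : \sum_i \sum_j cder i (curv2 j k) i j
  + \sum_i \sum_j cder j (curv2 k i) i j
  + \sum_i \sum_j cder k (curv2 i j) i j = 0.
  rewrite -!big_split big1 //= => i _; rewrite -!big_split big1 //= => j _.
  by rewrite -!addmxE bianchi2_curv2 mxE.
rewrite E1 E2 E3 in e.
by apply/eqP; rewrite -subr_eq0 -oppr_eq0 -[X in _ == X]e; apply/eqP; ring.
Qed.

Lemma dvg_dvg (w : 'M[K]_n) : w^T = - w -> dvg (fun j => dvg (w j)) = 0.
Proof.
move=> w_skew; have wE i j : w i j = - w j i.
  by have /matrixP/(_ j i) := w_skew; rewrite !mxE => <-.
have trC i j : d i (\tr (Gam j)) = d j (\tr (Gam i)).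
  have : \tr (curv i j) = 0.
    apply: eq_oppr0; rewrite -[in LHS](mulmx1 (curv i j)) -HG mulmxA.
    rewrite -/(curv2 i j) -[LHS]mxtrace_tr trmx_mul G_sym curv2_skew mulmxN.
    by rewrite linearN /= mxtrace_mulC -mulmxA HG mulmx1.
  rewrite /curv mxtraceD !linearB /= -!der_tr mxtrace_mulC subrr addr0.
  by move/eqP; rewrite subr_eq0 => /eqP.
rewrite /dvg.
rewrite (eq_bigr (fun j => \sum_i (d j (d i (w j i) + \tr (Gam i) * w j i)
   + \tr (Gam j) * (d i (w j i) + \tr (Gam i) * w j i)))); last first.
  by move=> j _; rewrite [RHS]big_split /= raddf_sum mulr_sumr.
apply: sum_antisym => i j.
rewrite wE !raddfN /= !raddfD /= !mulrN !raddfN /= !dM dC trC.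
by ring.
Qed.

Section Soliton.
Variables (V : 'rV[K]_n) (lam en : K).

Definition nab : 'M[K]_n :=
  \matrix_(i, k) (d i (V 0 k) + \sum_j Gam i k j * V 0 j).

Lemma nab_lie : nab *m G + G *m nab^T =
  \matrix_(i, j) \sum_k (V 0 k * d k (G i j) + G k j * d i (V 0 k)
                         + G i k * d j (V 0 k)).
Proof.
apply/matrixP => i j; rewrite addmxE !mxE -big_split /=.
have dG k : d k (G i j) = \sum_m (Gam i m k * G m j + G i m * Gam j m k).
  have /matrixP/(_ i j) := Gam_metric k; rewrite !mxE -big_split => -> /=.
  by apply: eq_bigr => m _; rewrite mxE (Gam_sym k i) (Gam_sym k j).
have -> : \sum_k (V 0 k * d k (G i j) + G k j * d i (V 0 k) + G i k * d j (V 0 k))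
  = \sum_k (\sum_m (Gam i k m * G k j + G i k * Gam j k m) * V 0 m
           + (G k j * d i (V 0 k) + G i k * d j (V 0 k))).
  under eq_bigr do rewrite -addrA; rewrite !big_split /=; congr (_ + _).
  rewrite exchange_big /=; apply: eq_bigr => k _.
  by rewrite dG mulrC mulr_suml.
apply: eq_bigr => k _; rewrite !mxE.
have -> : \sum_m (Gam i k m * G k j + G i k * Gam j k m) * V 0 m =
    (\sum_m Gam i k m * V 0 m) * G k j + G i k * \sum_m Gam j k m * V 0 m.
  rewrite mulr_suml mulr_sumr -big_split; apply: eq_bigr => m _ /=; ring.
by ring.
Qed.

Lemma row_nab i : row i nab = D i V + V *m (Gam i)^T.
Proof.
apply/rowP => k; rewrite !mxE; congr (_ + _); apply: eq_bigr => j _.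
by rewrite mxE mulrC.
Qed.

Lemma commutator_nab i j :
  D i (row j nab) + row j nab *m (Gam i)^T
  - (D j (row i nab) + row i nab *m (Gam j)^T) = V *m (curv i j)^T.
Proof.
rewrite !row_nab !map_mxD !der_mulmx -!map_trmx (derC j i) /curv.
rewrite !(trmxD, trmxN) !trmx_mul.
by mx_noncomm_ring.
Qed.

Lemma dvg_nab k : dvg (nab k) = d k (\tr nab)
  + \sum_i \sum_m Gam k i m * nab i m + \sum_m ric k m * V 0 m.
Proof.
have -> : \sum_m ric k m * V 0 m = \sum_i (V *m (curv i k)^T) 0 i.
  under [RHS]eq_bigr do rewrite mxE.
  rewrite exchange_big /=; apply: eq_bigr => m _.
  rewrite mxE mulr_suml; apply: eq_bigr => i _.
  by rewrite [in RHS]mxE mulrC.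
rewrite dvgE /mxtrace raddf_sum -!big_split /=; apply: eq_bigr => i _.
rewrite -commutator_nab !addmxE oppmxE !addmxE !mxE.
rewrite [X in _ - (_ + X)](_ : _ = \sum_m Gam k i m * nab i m); last first.
  by apply: eq_bigr => m _; rewrite !mxE mulrC.
rewrite [X in _ + (_ + X - _)](_ : _ = \sum_m Gam i i m * nab k m); last first.
  by apply: eq_bigr => m _; rewrite !mxE mulrC.
by ring.
Qed.

Hypothesis d_lam : forall i, d i lam = 0.
Hypothesis soliton : nab *m G + G *m nab^T + (ric + ric) = lam *: G.
Hypothesis en_def : en + en = (V *m G *m V^T) 0 0.

Lemma soliton_mixed : nab + G *m nab^T *m H + (ric_sharp + ric_sharp) = lam%:M.
Proof.
have := congr1 (mulmx^~ H) soliton.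
rewrite -scalemxAl GH scalemx1 => <-.
by rewrite /ric_sharp !mulmxDl -(mulmxA nab) GH mulmx1.
Qed.

Lemma tr_soliton i : d i (\tr nab) = - d i (\tr ric_sharp).
Proof.
have := congr1 (fun X => d i (\tr X)) soliton_mixed.
rewrite !mxtraceD mxtrace_mulC mulmxA HG mul1mx mxtrace_tr mxtrace_scalar.
rewrite !raddfD /= raddfMn /= d_lam mul0rn => e.
apply/eqP; rewrite -addr_eq0; apply/eqP/two_regular.
by rewrite -[RHS]e; ring.
Qed.

Lemma eq_dvg X Y : X =1 Y -> dvg X = dvg Y.
Proof. by move=> e; apply: eq_bigr => i _; rewrite e. Qed.

Lemma dvgD X Y : dvg (fun i => X i + Y i) = dvg X + dvg Y.
Proof.
by rewrite -big_split; apply: eq_bigr => i _ /=; rewrite raddfD mulrDr addrACA.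
Qed.

Lemma dvg_sumM (h : 'I_n -> K) (X : 'I_n -> 'I_n -> K) :
  dvg (fun i => \sum_k h k * X k i)
  = \sum_k h k * dvg (X k) + \sum_i \sum_k d i (h k) * X k i.
Proof.
under [X in _ = X + _]eq_bigr do rewrite mulr_sumr.
rewrite [X in _ = X + _]exchange_big -big_split /=; apply: eq_bigr => i _.
rewrite raddf_sum mulr_sumr -!big_split /=; apply: eq_bigr => k _.
by rewrite dM; ring.
Qed.

(* The 2-form nabla_i V_j - nabla_j V_i with its second index raised; [curl2]
   below has both indices raised. *)
Definition curl1 : 'M[K]_n := nab - G *m nab^T *m H.

Lemma curl1E : curl1 = nab + nab + (ric_sharp + ric_sharp) - lam%:M.
Proof. by rewrite -soliton_mixed /curl1; mx_noncomm_ring. Qed.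

Lemma dvg_curl1 k : dvg (curl1 k) = d k (\tr nab)
  + (\sum_m ric k m * V 0 m) *+ 2 + \sum_i \sum_m Gam k i m * curl1 i m.
Proof.
have -> : dvg (curl1 k) = dvg (nab k) + dvg (nab k)
    + (dvg (ric_sharp k) + dvg (ric_sharp k)) - \tr (Gam k) * lam.
  have -> : - (\tr (Gam k) * lam) = dvg (fun i => - (lam *+ (k == i))).
    rewrite /dvg (bigD1 k) //= eqxx raddfN /= d_lam oppr0 add0r mulrN.
    rewrite big1 ?addr0 // => i /negPf; rewrite eq_sym => ->.
    by rewrite raddfN raddf0 oppr0 mulr0 addr0.
  rewrite -!dvgD; apply: eq_dvg => i.
  by rewrite curl1E !addmxE oppmxE [_%:M _ _]mxE.
rewrite bianchi_contracted !dvg_nab.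
have -> : \sum_i \sum_m Gam k i m * curl1 i m =
   (\sum_i \sum_m Gam k i m * nab i m) *+ 2
   + (\sum_i \sum_m Gam k i m * ric_sharp i m) *+ 2 - \tr (Gam k) * lam.
  rewrite mulr_suml -!sumrMnl -sumrN -!big_split /=; apply: eq_bigr => i _.
  rewrite -!sumrMnl (_ : Gam k i i * lam = \sum_m Gam k i m * (lam *+ (i == m))).
    rewrite -sumrN -!big_split; apply: eq_bigr => m _ /=.
    by rewrite curl1E !addmxE oppmxE [_%:M _ _]mxE; ring.
  rewrite (bigD1 i) //= eqxx big1 ?addr0 // => m /negPf.
  by rewrite eq_sym => ->; rewrite mulr0.
by rewrite tr_soliton; ring.
Qed.

Definition curl2 : 'M[K]_n := H *m curl1.

Lemma curl2_skew : curl2^T = - curl2.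
Proof.
rewrite /curl2 mulmxBr !mulmxA HG mul1mx trmxD trmxN !trmx_mul trmxK inv_sym.
by rewrite opprB.
Qed.

Lemma dvg_curl2 j : dvg (curl2 j) =
  \sum_k H j k * (d k (\tr nab) + (\sum_m ric k m * V 0 m) *+ 2).
Proof.
have -> : dvg (curl2 j) = dvg (fun i => \sum_k H j k * curl1 k i).
  by apply: eq_dvg => i; rewrite mxE.
rewrite dvg_sumM; under eq_bigr do rewrite dvg_curl1 mulrDr.
rewrite big_split /= -[RHS]addr0 -addrA; congr (_ + _).
have dH i k : d i (H j k) =
    - (\sum_m H j m * Gam i k m + \sum_m Gam i j m * H m k).
  have /matrixP/(_ j k) := der_inv i; rewrite !mxE => ->.
  by congr (- (_ + _)); apply: eq_bigr => m _; rewrite mxE.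
have skew_pairing : \sum_i \sum_k (\sum_m Gam i j m * H m k) * curl1 k i = 0.
  transitivity (\sum_i \sum_m Gam i j m * curl2 m i).
    apply: eq_bigr => i _; under eq_bigr do rewrite mulr_suml.
    rewrite exchange_big; apply: eq_bigr => m _ /=.
    by rewrite mxE mulr_sumr; apply: eq_bigr => k _; rewrite mulrA.
  apply: sum_sym_skew => [a b|a b]; first exact: Gam_sym.
  by have /matrixP/(_ a b) := curl2_skew; rewrite [_^T _ _]mxE oppmxE.
have -> : \sum_i \sum_k d i (H j k) * curl1 k i =
    - \sum_i \sum_k (\sum_m H j m * Gam i k m) * curl1 k i.
  rewrite -[RHS]subr0 -[X in _ - X]skew_pairing -!sumrN -big_split.
  apply: eq_bigr => i _ /=; rewrite -!sumrN -big_split; apply: eq_bigr => k _ /=.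
  by rewrite dH; ring.
apply/eqP; rewrite subr_eq0; apply/eqP.
under eq_bigr do (rewrite mulr_sumr; under eq_bigr do rewrite mulr_sumr).
rewrite exchange_big [RHS]exchange_big; apply: eq_bigr => i _ /=.
rewrite exchange_big; apply: eq_bigr => m _ /=; rewrite mulr_suml.
by apply: eq_bigr => k _; rewrite (Gam_sym m k i) mulrA.
Qed.

Lemma dvgN X : dvg (fun i => - X i) = - dvg X.
Proof. by rewrite -sumrN; apply: eq_bigr => i _; rewrite raddfN mulrN opprD. Qed.

Lemma der_energy i : d i en = (nab *m G *m V^T) i 0.
Proof.
set y := RHS; have yE : y = (row i nab *m G *m V^T) 0 0.
  by rewrite -!row_mul mxE.
have y_tr : y = (V *m G *m (row i nab)^T) 0 0.
  rewrite yE -[in LHS](trmxK (_ *m V^T)) mxE !trmx_mul trmxK G_sym.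
  by rewrite mulmxA.
apply/eqP; rewrite -subr_eq0; apply/eqP/two_regular.
have e : d i en + d i en = y + y.
  rewrite {1}yE y_tr -addmxE -raddfD en_def.
  transitivity (D i (V *m G *m V^T) 0 0); first by rewrite [RHS]mxE.
  congr (fun_of_matrix _ 0 0).
  rewrite !der_mulmx Gam_metric -map_trmx row_nab trmxD trmx_mul trmxK.
  by mx_noncomm_ring.
by rewrite addrACA e; ring.
Qed.

Lemma soliton_vector_divergence_free (W : 'I_n -> K) :
  (forall j, W j = \sum_k H j k * d k (\tr ric_sharp) + \sum_k H j k * d k en
                   + (V *m nab) 0 j - lam * V 0 j) ->
  dvg W = 0.
Proof.
move=> WE.
have e j : W j = - dvg (curl2 j).
  have E : H *m (nab *m G *m V^T) + nab^T *m V^T - lam *: V^T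
         = - (H *m ((ric + ric) *m V^T)).
    apply/eqP; rewrite -addr_eq0; apply/eqP.
    have := congr1 (fun X => H *m (X *m V^T)) soliton.
    rewrite -scalemxAl -scalemxAr [H *m (G *m V^T)]mulmxA HG mul1mx => <-.
    rewrite !mulmxDl !mulmxDr.
    have -> : H *m (G *m nab^T *m V^T) = nab^T *m V^T.
      by rewrite !mulmxA HG mul1mx.
    by mx_noncomm_ring.
  move/matrixP/(_ j 0): E; rewrite !(addmxE, oppmxE) => E.
  have -> : W j = \sum_k H j k * d k (\tr ric_sharp)
     + ((H *m (nab *m G *m V^T)) j 0 + (nab^T *m V^T) j 0 - (lam *: V^T) j 0).
    rewrite WE -!addrA; congr (_ + (_ + (_ - _))).
    - by rewrite mxE; apply: eq_bigr => k _; rewrite der_energy.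
    - by rewrite -trmx_mul [RHS]mxE.
    - by rewrite !mxE.
  rewrite E mxE dvg_curl2 -sumrN -sumrN -big_split; apply: eq_bigr => k _ /=.
  rewrite -mulrN -mulrN -mulrDr tr_soliton; congr (_ * _).
  have -> : \sum_m ric k m * V 0 m = (ric *m V^T) k 0.
    by rewrite [RHS]mxE; apply: eq_bigr => m _; rewrite [V^T _ _]mxE.
  by rewrite mulmxDl addmxE; ring.
rewrite (eq_dvg e) dvgN dvg_dvg ?oppr0 //; exact: curl2_skew.
Qed.

End Soliton.

End DifferentialRing.

(** * Symmetry of second derivatives *)

Section Differentiability.
Context {R : realType} {V : normedModType R}.

Lemma near_eq_differentiable (W : normedModType R) (f g : V -> W) (x : V) :
  {near x, f =1 g} -> differentiable f x -> differentiable g x.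
Proof.
move=> fg df.
have fgx : f x = g x := nbhs_singleton fg.
have fg0 : \forall y \near 0, f (y + x) = g (y + x).
  by move: fg; rewrite (near_shift 0) /= subr0.
have hE : (g - f) \o shift x = cst ((g - f) x) + (\0 : V -> W) +o_ 0 id.
  apply/eqaddoP => _/posnumP[e]; near=> y.
  have fgy : f (y + x) = g (y + x) by near: y; exact: fg0.
  rewrite !fctE /= fgx fgy !subrr addr0 subrr normr0.
  by rewrite mulr_ge0.
have c0 : continuous (\0 : V -> W) by exact: cst_continuous.
have dgf : differentiable (g - f) x.
  by apply/diff_locallyP; rewrite (diff_unique c0 hE).
by rewrite -[g](subrK f); exact: differentiableD.
Unshelve. all: by end_near. Qed.

Lemma is_derive_line (f : V -> R) (y v : V) (s : R) :
  differentiable f (y + s *: v) ->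
  is_derive s 1 (fun t => f (y + t *: v)) ('D_v f (y + s *: v)).
Proof.
move=> dff; have df : derivable f (y + s *: v) v by exact: diff_derivable.
have e : (fun h : R => h^-1 *: (((fun t => f (y + t *: v)) \o shift s) (h *: 1)
                            - f (y + s *: v)))
  = (fun h => h^-1 *: ((f \o shift (y + s *: v)) (h *: v) - f (y + s *: v))).
  apply/funext => h /=; congr (_ *: (f _ - _)).
  by rewrite [h *: 1]mulr1 scalerDl addrCA addrA.
by split; rewrite /derivable /derive e.
Qed.

Lemma derive_translate (f : V -> R) (x u v : V) :
  'D_v (fun z => f (z + u)) x = 'D_v f (x + u).
Proof.
have e : (fun h : R => h^-1 *: (((fun z => f (z + u)) \o shift x) (h *: v)
                             - f (x + u)))
  = (fun h => h^-1 *: ((f \o shift (x + u)) (h *: v) - f (x + u))).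
  by apply/funext => h /=; rewrite addrA.
by rewrite /derive e.
Qed.

Lemma MVT_line (f : V -> R) (y v : V) (t : R) : 0 < t ->
  (forall s, 0 <= s <= t -> differentiable f (y + s *: v)) ->
  exists2 s, 0 <= s <= t & f (y + t *: v) - f y = t * 'D_v f (y + s *: v).
Proof.
move=> t0 df.
have [||s + e] := @MVT R (fun t => f (y + t *: v))
    (fun s => 'D_v f (y + s *: v)) 0 t t0.
- by move=> s /[!in_itv]/= /andP[s0 st]; apply/is_derive_line/df; rewrite !ltW.
- apply: derivable_within_continuous => s /[!in_itv]/= st.
  by have [] := is_derive_line (df s st).
rewrite in_itv/= => /andP[s0 st]; exists s; first by rewrite !ltW.
by move: e; rewrite scale0r addr0 subr0 mulrC.
Qed.

Lemma second_difference (f : V -> R) (x v w : V) (t : R) : 0 < t ->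
  (forall a b, 0 <= a <= t -> 0 <= b <= t ->
     differentiable f (x + a *: v + b *: w)) ->
  (forall a b, 0 <= a <= t -> 0 <= b <= t ->
     differentiable ('D_v f) (x + a *: v + b *: w)) ->
  exists a b, [/\ 0 <= a <= t, 0 <= b <= t &
    f (x + t *: v + t *: w) - f (x + t *: v) - f (x + t *: w) + f x
    = t * (t * 'D_w ('D_v f) (x + a *: v + b *: w))].
Proof.
move=> t0 df dvf.
have t0t : 0 <= t <= t by rewrite lexx ltW.
have z0t : (0 : R) <= 0 <= t by rewrite lexx ltW.
pose F z := f (z + t *: w) - f z.
have dF1 a : 0 <= a <= t -> differentiable (fun z => f (z + t *: w)) (x + a *: v).
  move=> at0; apply: (@differentiable_comp _ _ _ _ (fun z => z + t *: w) f) => //.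
  exact: df.
have dF2 a : 0 <= a <= t -> differentiable f (x + a *: v).
  by move=> at0; have := df a 0 at0 z0t; rewrite scale0r addr0.
have [a at0 Ea] : exists2 a, 0 <= a <= t &
    F (x + t *: v) - F x = t * 'D_v F (x + a *: v).
  apply: MVT_line => // s st; apply: differentiableB; [exact: dF1|exact: dF2].
have [b bt0 Eb] : exists2 b, 0 <= b <= t &
    'D_v f (x + a *: v + t *: w) - 'D_v f (x + a *: v) =
    t * 'D_w ('D_v f) (x + a *: v + b *: w).
  by apply: (@MVT_line ('D_v f) (x + a *: v) w t t0) => s st; exact: dvf.
exists a, b; split=> //; rewrite -Eb.
have -> : 'D_v f (x + a *: v + t *: w) - 'D_v f (x + a *: v) = 'D_v F (x + a *: v).
  rewrite [RHS]deriveB; last 2 first.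
  - by apply: diff_derivable; exact: dF1.
  - by apply: diff_derivable; exact: dF2.
  by rewrite derive_translate.
by rewrite -Ea /F; ring.
Qed.

Lemma derive_comm (U : set V) (f : V -> R) (x v w : V) :
  open U -> U x ->
  (forall y, U y -> [/\ differentiable f y, differentiable ('D_v f) y &
                        differentiable ('D_w f) y]) ->
  {for x, continuous ('D_w ('D_v f))} -> {for x, continuous ('D_v ('D_w f))} ->
  'D_w ('D_v f) x = 'D_v ('D_w f) x.
Proof.
move=> oU Ux df cvw cwv; apply/eqP/negPn/negP => ne.
set A := 'D_w ('D_v f) in cvw ne *; set B := 'D_v ('D_w f) in cwv ne *.
pose e := `|A x - B x| / 2.
have e0 : 0 < e by rewrite divr_gt0 ?normr_gt0 ?subr_eq0.
have : nbhs x (U `&` [set y | `|A x - A y| < e] `&` [set y | `|B x - B y| < e]).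
  apply: filterI; first apply: filterI; first exact: open_nbhs_nbhs.
    by move/cvgrPdist_lt: cvw => /(_ _ e0).
  by move/cvgrPdist_lt: cwv => /(_ _ e0).
move=> /nbhs_ballP[r /= r0 rU].
pose K := `|v| + `|w| + 1.
have K0 : 0 < K by rewrite ltr_wpDl ?addr_ge0.
pose t := r / K.
have t0 : 0 < t by rewrite divr_gt0.
have box a b : 0 <= a <= t -> 0 <= b <= t -> ball x r (x + a *: v + b *: w).
  move=> /andP[a0 at0] /andP[b0 bt0].
  rewrite -ball_normE /= -addrA opprD addrA subrr sub0r normrN.
  apply: (le_lt_trans (ler_normD _ _)); rewrite !normrZ !ger0_norm //.
  apply: (@le_lt_trans _ _ (t * (`|v| + `|w|))).
    by rewrite mulrDr lerD // ler_wpM2r.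
  rewrite /t mulrAC ltr_pdivrMr // ltr_pM2l // /K.
  by rewrite ltrDl.
have box' a b : 0 <= a <= t -> 0 <= b <= t -> ball x r (x + a *: w + b *: v).
  by move=> ? ?; rewrite addrAC; exact: box.
have [||a [b [ab1 ab2 Eab]]] := @second_difference f x v w t t0.
- by move=> a b a1 b1; have /rU[[/df[]]] := box a b a1 b1.
- by move=> a b a1 b1; have /rU[[/df[]]] := box a b a1 b1.
have [||a' [b' [ab1' ab2' Eab']]] := @second_difference f x w v t t0.
- by move=> a' b' a1 b1; have /rU[[/df[]]] := box' a' b' a1 b1.
- by move=> a' b' a1 b1; have /rU[[/df[]]] := box' a' b' a1 b1.
have {}Eab : _ = t * (t * A (x + a *: v + b *: w)) := Eab.
have {}Eab' : _ = t * (t * B (x + a' *: w + b' *: v)) := Eab'.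
clearbody A B.
have EAB : A (x + a *: v + b *: w) = B (x + a' *: w + b' *: v).
  apply: (mulfI (lt0r_neq0 t0)); apply: (mulfI (lt0r_neq0 t0)).
  rewrite -Eab -Eab' (addrAC x (t *: w)).
  by congr (_ + _); exact: addrAC.
have /rU[[_ /= A1] _] := box _ _ ab1 ab2.
have /rU[_ /= B1] := box' _ _ ab1' ab2'.
have {A1 B1} AB : `|A x - A (x + a *: v + b *: w)|
    + `|B x - B (x + a' *: w + b' *: v)| < e + e := ltrD A1 B1.
have : `|A x - B x| < e + e.
  by apply: le_lt_trans AB; rewrite -EAB (distrC (B x)); exact: ler_distD.
by rewrite /e -splitr ltxx.
Qed.

End Differentiability.

(** * Closure properties of smooth functions *)

Section SmoothOn.
Context {R : realType} {n : nat}.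
Variable U : set 'rV[R]_n.
Hypothesis oU : open U.
Implicit Types f g : 'rV[R]_n -> R.

Lemma near_open (P : 'rV[R]_n -> Prop) x :
  U x -> (forall y, U y -> P y) -> \forall y \near x, P y.
Proof. by move=> Ux UP; apply: filterS UP _; exact: open_nbhs_nbhs. Qed.

Lemma eq_on_differentiable f g x :
  U x -> {in U, f =1 g} -> differentiable f x -> differentiable g x.
Proof.
move=> Ux fg; apply: near_eq_differentiable; apply: near_open => // y Uy.
by apply: fg; rewrite inE.
Qed.

Lemma eq_on_partial f g i x :
  U x -> {in U, f =1 g} -> partial i f x = partial i g x.
Proof.
move=> Ux fg; apply: near_eq_derive; apply: near_open => // y Uy.
by apply: fg; rewrite inE.
Qed.

Lemma smooth_on_differentiable f x : smooth_on U f -> U x -> differentiable f x.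
Proof. by move=> sf Ux; exact: (sf [::]). Qed.

Lemma smooth_on_partial f i : smooth_on U f -> smooth_on U (partial i f).
Proof. by move=> sf s x Ux; have := sf (rcons s i) x Ux; rewrite foldr_rcons. Qed.

Lemma partialC f i j x : smooth_on U f -> U x ->
  partial i (partial j f) x = partial j (partial i f) x.
Proof.
move=> sf Ux; apply: (derive_comm oU) => // [y Uy||].
- split; [|exact: (smooth_on_partial _ sf [::])..].
  exact: (sf [::]).
- by apply: differentiable_continuous; exact: (sf [:: i; j]).
- by apply: differentiable_continuous; exact: (sf [:: j; i]).
Qed.

Lemma partialD f g i x : differentiable f x -> differentiable g x ->
  partial i (f + g) x = partial i f x + partial i g x.
Proof. by move=> df dg; apply: deriveD; exact: diff_derivable. Qed.

Lemma partialM f g i x : differentiable f x -> differentiable g x ->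
  partial i (f * g) x = partial i f x * g x + f x * partial i g x.
Proof.
move=> df dg; rewrite addrC [X in _ + X]mulrC.
by apply: deriveM; exact: diff_derivable.
Qed.

(* This class is stable under [partial] by a single induction, which gives all the
   closure properties of [smooth_on] at once. *)
Inductive smooth_closure : ('rV[R]_n -> R) -> Prop :=
| sc_smooth f : smooth_on U f -> smooth_closure f
| sc_cst c : smooth_closure (cst c)
| sc_add f g : smooth_closure f -> smooth_closure g -> smooth_closure (f + g)
| sc_mul f g : smooth_closure f -> smooth_closure g -> smooth_closure (f * g)
| sc_inv f : (forall x, U x -> f x != 0) -> smooth_closure f ->
    smooth_closure (fun x => (f x)^-1)
| sc_ext f g : {in U, f =1 g} -> smooth_closure f -> smooth_closure g.

Lemma smooth_closure_differentiable f x :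
  smooth_closure f -> U x -> differentiable f x.
Proof.
move=> sf Ux; elim: sf => {f} [f|c|f g _ df _ dg|f g _ df _ dg|f f0 _ df|f g fg _ df].
- by move=> sf; exact: (sf [::]).
- exact: differentiable_cst.
- exact: differentiableD.
- exact: differentiableM.
- by apply: differentiableV => //; exact: f0.
- exact: eq_on_differentiable df.
Qed.

Lemma smooth_closure_partial f i : smooth_closure f -> smooth_closure (partial i f).
Proof.
elim=> {f} [f sf|c|f g sf df sg dg|f g sf df sg dg|f f0 sf df|f g fg sf df].
- by apply: sc_smooth; exact: smooth_on_partial.
- apply: (@sc_ext (cst 0)); last exact: sc_cst.
  by move=> x _; rewrite /partial derive_cst.
- apply: sc_ext (sc_add df dg) => x /[!inE] Ux.
  by rewrite partialD //; exact: smooth_closure_differentiable.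
- apply: sc_ext (sc_add (sc_mul df sg) (sc_mul sf dg)) => x /[!inE] Ux.
  by rewrite partialM //; exact: smooth_closure_differentiable.
- have sV := sc_inv f0 sf.
  apply: sc_ext (sc_mul (sc_cst (-1)) (sc_mul (sc_mul sV sV) df)) => x /[!inE] Ux.
  rewrite /partial deriveV; last 2 first.
  + exact: f0.
  + by apply: diff_derivable; exact: smooth_closure_differentiable.
  by rewrite !fctE mulN1r -mulNr -exprVn expr2.
- by apply: sc_ext df => x /[!inE] Ux; exact: eq_on_partial.
Qed.

Lemma smooth_closureP f : smooth_closure f -> smooth_on U f.
Proof.
move=> sf s x Ux; apply: smooth_closure_differentiable => //.
by elim: s => //= i s; exact: smooth_closure_partial.
Qed.

End SmoothOn.

Lemma smooth_cst {R : realType} {n : nat} (U : set 'rV[R]_n) (a : R) :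
  open U -> smooth_on U (cst a).
Proof. by move=> oU; apply: (smooth_closureP oU); exact: sc_cst. Qed.

(** * The ring of smooth functions on an open set *)

Section SmoothRing.
Context {R : realType} {n : nat} {U : set 'rV[R]_n}.
Hypothesis oU : open U.

Notation T := {x : 'rV[R]_n | U x}.

Definition extend0 (f : T -> R) (x : 'rV[R]_n) : R :=
  if pselect (U x) is left Ux then f (exist _ x Ux) else 0.

Lemma extend0E f (t : T) : extend0 f (sval t) = f t.
Proof.
rewrite /extend0; case: pselect => [Ux|]; last by case: t.
by case: t Ux => x Ux Ux'; congr (f (exist _ x _)); exact: Prop_irrelevance.
Qed.

(* The unused proof that [U] is open lets the ring structure below, which needs
   it, be inferred from the type. *)
Definition smooth_fun (_ : open U) : {pred T -> R} :=
  fun f => `[< smooth_on U (extend0 f) >].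

Record smoothFun := SmoothFun {
  sfun_val :> T -> R ;
  sfun_valP : sfun_val \in smooth_fun oU
}.

HB.instance Definition _ := [isSub for sfun_val].
HB.instance Definition _ := [Choice of smoothFun by <:].

Lemma smooth_fun_subring : subring_closed (smooth_fun oU).
Proof.
have sE f : f \in smooth_fun oU -> smooth_closure U (extend0 f).
  by move=> /asboolP sf; exact: sc_smooth.
split.
- apply/asboolP/(smooth_closureP oU); apply: sc_ext (sc_cst U 1).
  by move=> x /[!inE] Ux; rewrite (extend0E _ (exist _ x Ux)).
- move=> f g /sE sf /sE sg; apply/asboolP/(smooth_closureP oU).
  apply: sc_ext (sc_add sf (sc_mul (sc_cst U (-1)) sg)) => x /[!inE] Ux.
  rewrite (extend0E _ (exist _ x Ux)) !fctE.
  by rewrite !(extend0E _ (exist _ x Ux)) mulN1r.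
- move=> f g /sE sf /sE sg; apply/asboolP/(smooth_closureP oU).
  apply: sc_ext (sc_mul sf sg) => x /[!inE] Ux.
  rewrite (extend0E _ (exist _ x Ux)) !fctE.
  by rewrite !(extend0E _ (exist _ x Ux)).
Qed.

HB.instance Definition _ :=
  GRing.isSubringClosed.Build _ (smooth_fun oU) smooth_fun_subring.
HB.instance Definition _ := GRing.SubChoice_isSubComPzRing.Build _ _ smoothFun
  (subringClosedP _).

Lemma smoothFunP (f g : smoothFun) : f =1 g -> f = g.
Proof. by move=> fg; apply/val_inj/funext. Qed.

Lemma extend0_smooth (f : smoothFun) : smooth_on U (extend0 f).
Proof. by have /asboolP := sfun_valP f. Qed.

Definition ev (t : T) (f : smoothFun) : R := f t.

Lemma ev_zmod t : zmod_morphism (ev t).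
Proof. by move=> f g. Qed.

Lemma ev_monoid t : monoid_morphism (ev t).
Proof. by split=> [|f g]. Qed.

HB.instance Definition _ t := GRing.isZmodMorphism.Build _ _ (ev t) (ev_zmod t).
HB.instance Definition _ t :=
  GRing.isMonoidMorphism.Build _ _ (ev t) (ev_monoid t).

Lemma evD t f g : ev t (f + g) = ev t f + ev t g.
Proof. by []. Qed.

Lemma evM t f g : ev t (f * g) = ev t f * ev t g.
Proof. by []. Qed.

Lemma ev_inj (f g : smoothFun) : (forall t, ev t f = ev t g) -> f = g.
Proof. exact: smoothFunP. Qed.

Lemma ev_mx_inj p q (A B : 'M[smoothFun]_(p, q)) :
  (forall t, map_mx (ev t) A = map_mx (ev t) B) -> A = B.
Proof.
move=> e; apply/matrixP => i j; apply: ev_inj => t.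
by have /matrixP/(_ i j) := e t; rewrite !mxE.
Qed.

Lemma restrict_subproof (f : 'rV[R]_n -> R) :
  {h : smoothFun | smooth_on U f -> forall t, ev t h = f (sval t)}.
Proof.
case: (pselect (smooth_on U f)) => [sf|?]; last by exists 0.
have hP : (fun t : T => f (sval t)) \in smooth_fun oU.
  apply/asboolP/(smooth_closureP oU); apply: sc_ext (sc_smooth sf).
  by move=> x /[!inE] Ux; rewrite (extend0E _ (exist _ x Ux)).
by exists (SmoothFun hP).
Qed.

Definition restrict f : smoothFun := sval (restrict_subproof f).

Lemma restrictE f t : smooth_on U f -> ev t (restrict f) = f (sval t).
Proof. by rewrite /restrict; case: restrict_subproof => h /= /[apply]. Qed.

Definition pder i (f : smoothFun) : smoothFun := restrict (partial i (extend0 f)).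

Lemma pderE i f t : ev t (pder i f) = partial i (extend0 f) (sval t).
Proof. by rewrite restrictE //; exact/smooth_on_partial/extend0_smooth. Qed.

(* Failing unifications otherwise unfold these constants at prohibitive cost. *)
Opaque restrict pder.

Lemma pder_eq_on i f g t : (forall s, ev s f = g (sval s)) ->
  ev t (pder i f) = partial i g (sval t).
Proof.
move=> fg; rewrite pderE; apply: (eq_on_partial oU); first exact: svalP.
by move=> x /[!inE] Ux; rewrite (extend0E _ (exist _ x Ux)) [LHS]fg.
Qed.

Lemma extend0_differentiable (f : smoothFun) (t : T) :
  differentiable (extend0 f) (sval t).
Proof. exact: smooth_on_differentiable (extend0_smooth f) (svalP t). Qed.

Lemma pder_zmod i : zmod_morphism (pder i).
Proof.
move=> f g; apply: ev_inj => t; rewrite rmorphB /= !pderE.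
rewrite -[RHS]deriveB; try by apply: diff_derivable; exact: extend0_differentiable.
apply: (eq_on_partial oU); first exact: svalP.
move=> x /[!inE] Ux; rewrite fctE !(extend0E _ (exist _ x Ux)).
by rewrite -[(- extend0 g) x]/(- extend0 g x) (extend0E g (exist _ x Ux)).
Qed.

HB.instance Definition _ i := GRing.isZmodMorphism.Build _ _ (pder i) (pder_zmod i).

Lemma pderM i f g : pder i (f * g) = pder i f * g + f * pder i g.
Proof.
apply: ev_inj => t; rewrite evD (evM t (pder i f)) (evM t f) !pderE.
have -> : ev t f = extend0 f (sval t) by rewrite extend0E.
have -> : ev t g = extend0 g (sval t) by rewrite extend0E.
rewrite -partialM; try exact: extend0_differentiable.
apply: (eq_on_partial oU); first exact: svalP.
move=> x /[!inE] Ux; rewrite -[(extend0 f * _) x]/(extend0 f x * extend0 g x).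
by rewrite !(extend0E _ (exist _ x Ux)).
Qed.

Lemma pderC i j f : pder i (pder j f) = pder j (pder i f).
Proof.
have e k l t :
    ev t (pder k (pder l f)) = partial k (partial l (extend0 f)) (sval t).
  by apply: pder_eq_on => s; exact: pderE.
apply: ev_inj => t; apply: etrans (e i j t) _; apply: etrans _ (esym (e j i t)).
exact: (partialC oU i j (extend0_smooth f) (svalP t)).
Qed.

Lemma smooth_two_regular (f : smoothFun) : f + f = 0 -> f = 0.
Proof.
move=> ff; apply: ev_inj => t; have : ev t (f + f) = 0 by rewrite ff.
by rewrite evD -mulr2n => /eqP; rewrite mulrn_eq0 => /eqP.
Qed.

End SmoothRing.

(** * Solitons in a chart *)

Section Chart.
Context {R : realType} {n : nat} {M : smoothManifold R n}.
Variables (g : riemannianMetric M) (V : vectorField M) (lambda : R).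
Variable c : chart R n M.
Hypothesis Ac : atlas c.

Let U := chart_cod c.
Let oU : open U := @chart_cod_open R n M c.
Notation K := (smoothFun oU).
Notation T := {x : 'rV[R]_n | U x}.

Lemma metric_unit x : U x -> g c x \in unitmx.
Proof.
move=> Ux; rewrite unitmxE unitfE; apply/det0P => -[u u0 ug].
by have := metric_posdef g Ac Ux u0; rewrite ug mul0mx mxE ltxx.
Qed.

Definition metricK : 'M[K]_n := \matrix_(i, j) restrict oU (fun x => g c x i j).

Lemma metricKE i j t : ev t (metricK i j) = g c (sval t) i j.
Proof. by rewrite mxE restrictE //; exact: metric_smooth. Qed.

Lemma ev_metricK t : map_mx (ev t) metricK = g c (sval t).
Proof. by apply/matrixP => i j; rewrite mxE metricKE. Qed.

Lemma metricK_sym : metricK^T = metricK.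
Proof.
apply: ev_mx_inj => t; rewrite -map_trmx ev_metricK.
exact: (Defs.metric_sym g Ac (svalP t)).
Qed.

Lemma det_metric_smooth : smooth_on U (fun x => (\det (g c x))^-1).
Proof.
apply: (smooth_closureP oU); apply: sc_inv => [x Ux|].
  by rewrite -unitfE -unitmxE metric_unit.
apply: sc_ext (sc_smooth (extend0_smooth (\det metricK))) => x /[!inE] Ux.
rewrite (extend0E _ (exist _ x Ux)) -[LHS]/(ev _ _) -det_map_mx.
by rewrite ev_metricK.
Qed.

Definition invK : 'M[K]_n :=
  restrict oU (fun x => (\det (g c x))^-1) *: \adj metricK.

Lemma ev_invK t : map_mx (ev t) invK = metric_inv g c (sval t).
Proof.
rewrite /metric_inv /invmx metric_unit; last exact: svalP.
rewrite map_mxZ map_mx_adj ev_metricK /= restrictE //; exact: det_metric_smooth.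
Qed.

Lemma metricK_invK : metricK *m invK = 1%:M.
Proof.
apply: ev_mx_inj => t; rewrite map_mxM map_mx1 ev_metricK ev_invK.
by rewrite mulmxV // metric_unit //; exact: svalP.
Qed.

Definition halfK : K := restrict oU (cst 2^-1).

Lemma ev_halfK t : ev t halfK = 2^-1.
Proof. by rewrite restrictE //; exact: smooth_cst. Qed.

Lemma halfK_def : halfK + halfK = 1.
Proof.
apply: ev_inj => t; rewrite evD ev_halfK -[RHS]/(1 : R).
by field.
Qed.

Notation d := (pder (oU := oU)).

Lemma evN t (f : K) : ev t (- f) = - ev t f.
Proof. by []. Qed.

Lemma ev_sum (I : finType) t (F : I -> K) :
  ev t (\sum_i F i) = \sum_i ev t (F i).
Proof. exact: raddf_sum. Qed.

Definition christoffelK : 'I_n -> 'M[K]_n := levi_civita d metricK invK halfK.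

Opaque metricK invK halfK first_kind.

Lemma christoffelKE i k j t :
  ev t (christoffelK i k j) = christoffel g c (sval t) k i j.
Proof.
have dG a b l : ev t (d l (metricK a b)) = partial l (fun y => g c y a b) (sval t).
  by apply: pder_eq_on => s; exact: metricKE.
transitivity (map_mx (ev t) (christoffelK i) k j); first by rewrite [RHS]mxE.
rewrite map_mxZ map_mxM ev_invK /= ev_halfK [LHS]mxE [X in _ * X]mxE.
congr (_ * _); apply: eq_bigr => l _; congr (_ * _).
rewrite [LHS]mxE [X in ev t X]mxE evD evN evD (dG j l i) (dG i l j).
by rewrite (dG i j l).
Qed.

Opaque christoffelK.

Lemma pder_christoffelK l i k j t : ev t (d l (christoffelK i k j)) =
  partial l (fun y => christoffel g c y k i j) (sval t).
Proof. by apply: pder_eq_on => s; exact: christoffelKE. Qed.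

Lemma ev_mulmx p q r t (A : 'M[K]_(p, q)) (B : 'M[K]_(q, r)) i j :
  ev t ((A *m B) i j) = \sum_k ev t (A i k) * ev t (B k j).
Proof. by rewrite mxE ev_sum; apply: eq_bigr => k _; rewrite evM. Qed.

Lemma ev_curv i j l k t :
  ev t (curv d christoffelK i j l k) = riemann g c (sval t) l k i j.
Proof.
rewrite curv_entry.
transitivity (ev t (d i (christoffelK j l k)) - ev t (d j (christoffelK i l k))
  + ev t (\sum_m (christoffelK i l m * christoffelK j m k
                  - christoffelK j l m * christoffelK i m k))).
  by [].
congr (_ - _ + _); [exact: pder_christoffelK|exact: pder_christoffelK|rewrite ev_sum].
apply: eq_bigr => m _.
rewrite -[LHS]/(ev t (christoffelK i l m) * ev t (christoffelK j m k)
             - ev t (christoffelK j l m) * ev t (christoffelK i m k)).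
by congr (_ * _ - _ * _); exact: christoffelKE.
Qed.

Lemma ev_ric t : map_mx (ev t) (ric d christoffelK) = ricci g c (sval t).
Proof.
apply/matrixP => j k; rewrite !mxE ev_sum; apply: eq_bigr => i _.
exact: ev_curv.
Qed.

Definition fieldK : 'rV[K]_n := \row_k restrict oU (fun x => V c x 0 k).

Lemma fieldKE k t : ev t (fieldK 0 k) = V c (sval t) 0 k.
Proof. by rewrite mxE restrictE //; exact: vf_smooth. Qed.

Opaque fieldK.

Lemma ev_fieldK t : map_mx (ev t) fieldK = V c (sval t).
Proof. by apply/rowP => k; rewrite mxE fieldKE. Qed.

Lemma ev_nab i k t :
  ev t (nab d christoffelK fieldK i k) = cov_deriv g V c (sval t) i k.
Proof.
rewrite mxE evD ev_sum; congr (_ + _).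
  by apply: pder_eq_on => s; exact: fieldKE.
apply: eq_bigr => j _; rewrite -[LHS]/(ev t (christoffelK i k j) * ev t (fieldK 0 j)).
by congr (_ * _); [exact: christoffelKE|exact: fieldKE].
Qed.

Hypothesis soliton : forall x, U x ->
  2^-1 *: lie_metric g V c x + ricci g c x = (lambda / 2) *: g c x.

Definition lamK : K := restrict oU (cst lambda).

Lemma lamKE t : ev t lamK = lambda.
Proof. by rewrite restrictE //; exact: smooth_cst. Qed.

Lemma pder_lamK i : d i lamK = 0.
Proof.
apply: ev_inj => t; rewrite (pder_eq_on i t lamKE).
by rewrite /partial derive_cst.
Qed.

Lemma solitonK : nab d christoffelK fieldK *m metricK
  + metricK *m (nab d christoffelK fieldK)^T
  + (ric d christoffelK + ric d christoffelK) = lamK *: metricK.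
Proof.
apply: ev_mx_inj => t.
rewrite map_mxZ /= lamKE !map_mxD ev_ric ev_metricK.
rewrite -map_mxD (@nab_lie _ _ d metricK christoffelK); last 2 first.
- exact: levi_civita_sym metricK_sym.
- exact: levi_civita_metric metricK_sym metricK_invK halfK_def.
have -> : map_mx (ev t) (\matrix_(i, j) \sum_k (fieldK 0 k * d k (metricK i j)
    + metricK k j * d i (fieldK 0 k) + metricK i k * d j (fieldK 0 k)))
  = lie_metric g V c (sval t).
  apply/matrixP => i j; rewrite [LHS]mxE [X in ev t X]mxE [RHS]mxE ev_sum.
  apply: eq_bigr => k _; rewrite -[LHS]/(ev t (fieldK 0 k) * ev t (d k (metricK i j))
    + ev t (metricK k j) * ev t (d i (fieldK 0 k))
    + ev t (metricK i k) * ev t (d j (fieldK 0 k))).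
  congr (_ * _ + _ * _ + _ * _); [exact: fieldKE| |exact: metricKE| |exact: metricKE|].
  - by apply: pder_eq_on => s; exact: metricKE.
  - by apply: pder_eq_on => s; exact: fieldKE.
  - by apply: pder_eq_on => s; exact: fieldKE.
have := soliton (svalP t); set L := lie_metric _ _ _ _; set Rc := ricci _ _ _.
move=> e; have {e} -> : L = lambda *: g c (sval t) - (Rc + Rc).
  apply/matrixP => i j; move/matrixP/(_ i j): e; rewrite !mxE => e; lra.
by rewrite subrK.
Qed.

Lemma metric_inv_sym x i j : U x -> metric_inv g c x i j = metric_inv g c x j i.
Proof.
move=> Ux; have e : (metric_inv g c x)^T = metric_inv g c x.
  by rewrite /metric_inv trmx_inv (Defs.metric_sym g Ac Ux).
by rewrite -[in LHS]e mxE.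
Qed.

Notation ricciK := (ric_sharp d invK christoffelK).

Lemma tr_ricciK t : ev t (\tr ricciK) =
  \sum_i \sum_j metric_inv g c (sval t) i j * ricci g c (sval t) i j.
Proof.
rewrite -trace_map_mx map_mxM ev_ric ev_invK; apply: eq_bigr => i _.
rewrite mxE; apply: eq_bigr => j _.
by rewrite mulrC; congr (_ * _); apply: metric_inv_sym; exact: svalP.
Qed.

Definition energyK : K := halfK * (fieldK *m metricK *m fieldK^T) 0 0.

Lemma energyKE t : ev t energyK =
  2^-1 * (V c (sval t) *m g c (sval t) *m (V c (sval t))^T) 0 0.
Proof.
rewrite -[LHS]/(ev t halfK * ev t ((fieldK *m metricK *m fieldK^T) 0 0)) ev_halfK.
congr (_ * _).
transitivity (map_mx (ev t) (fieldK *m metricK *m fieldK^T) 0 0).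
  by rewrite [RHS]mxE.
by rewrite !map_mxM -map_trmx ev_fieldK ev_metricK.
Qed.

Lemma energyKD : energyK + energyK = (fieldK *m metricK *m fieldK^T) 0 0.
Proof. by rewrite -mulrDl halfK_def mul1r. Qed.

Opaque energyK.

Definition solitonW j : K :=
  \sum_k invK j k * d k (\tr ricciK) + \sum_k invK j k * d k energyK
  + (fieldK *m nab d christoffelK fieldK) 0 j - lamK * fieldK 0 j.

Lemma div_solitonW : dvg d christoffelK solitonW = 0.
Proof.
apply: (soliton_vector_divergence_free (@pderM R n U oU) (@pderC R n U oU)
  (@smooth_two_regular R n U oU) metricK_sym metricK_invK
  (levi_civita_sym d invK halfK metricK_sym)
  (levi_civita_metric d metricK_sym metricK_invK halfK_def)
  pder_lamK solitonK energyKD).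
by move=> j; rewrite /solitonW.
Qed.

Variables fS fE : M -> R.
Hypothesis fSE : forall y, U y -> fS (chart_inv c y) =
  \sum_i \sum_j metric_inv g c y i j * ricci g c y i j.
Hypothesis fEE : forall y, U y -> fE (chart_inv c y) =
  2^-1 * (V c y *m g c y *m (V c y)^T) 0 0.

Definition solitonX : components :=
  gradient g fS + gradient g fE + nabla g V V - lambda *: (V : components).

Lemma solitonWE j t : ev t (solitonW j) = solitonX c (sval t) 0 j.
Proof.
rewrite -[RHS]/((gradient g fS c (sval t) + gradient g fE c (sval t)
   + nabla g V V c (sval t) - lambda *: V c (sval t)) 0 j).
rewrite !addmxE oppmxE.
rewrite -[LHS]/(ev t (\sum_k invK j k * d k (\tr ricciK))
  + ev t (\sum_k invK j k * d k energyK)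
  + ev t ((fieldK *m nab d christoffelK fieldK) 0 j) - ev t lamK * ev t (fieldK 0 j)).
have evH k : ev t (invK j k) = metric_inv g c (sval t) j k.
  by rewrite -ev_invK [RHS]mxE.
congr (_ + _ + _ - _).
- rewrite ev_sum [RHS]mxE; apply: eq_bigr => k _.
  rewrite -[LHS]/(ev t (invK j k) * ev t (d k (\tr ricciK))) evH; congr (_ * _).
  apply: pder_eq_on => s /=; rewrite fSE; [exact: tr_ricciK|exact: svalP].
- rewrite ev_sum [RHS]mxE; apply: eq_bigr => k _.
  rewrite -[LHS]/(ev t (invK j k) * ev t (d k energyK)) evH; congr (_ * _).
  apply: pder_eq_on => s /=; rewrite fEE; [exact: energyKE|exact: svalP].
- rewrite ev_mulmx [RHS]mxE; apply: eq_bigr => k _.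
  by congr (_ * _); [exact: fieldKE|exact: ev_nab].
- by rewrite [RHS]mxE; congr (_ * _); [exact: lamKE|exact: fieldKE].
Qed.

Lemma chart_divergence x : U x -> \sum_i cov_deriv g solitonX c x i i = 0.
Proof.
move=> Ux; pose t : T := exist _ x Ux.
have := congr1 (ev t) div_solitonW.
rewrite (dvgE _ (levi_civita_sym d invK halfK metricK_sym)) ev_sum => e0.
rewrite -[RHS]e0.
apply: eq_bigr => i _.
rewrite -[RHS]/(ev t (d i (solitonW i))
  + ev t (\sum_j christoffelK i i j * solitonW j)).
congr (_ + _).
  by apply/esym/pder_eq_on => s; exact: solitonWE.
rewrite ev_sum; apply: eq_bigr => j _.
rewrite -[RHS]/(ev t (christoffelK i i j) * ev t (solitonW j)).
by congr (_ * _); apply/esym; [exact: christoffelKE|exact: solitonWE].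
Qed.

End Chart.

(** * Change of charts *)

Section MatrixPartial.
Context {R : realType} {n : nat}.
Notation point := 'rV[R]_n.

Definition mx_differentiable p q (F : point -> 'M[R]_(p, q)) x :=
  forall i j, differentiable (fun y => F y i j) x.

Definition mx_partial p q k (F : point -> 'M[R]_(p, q)) x : 'M[R]_(p, q) :=
  \matrix_(i, j) partial k (fun y => F y i j) x.

Lemma fun_mulmxE p q r (F : point -> 'M[R]_(p, q)) (H : point -> 'M[R]_(q, r)) i j :
  (fun y => (F y *m H y) i j)
  = \sum_(k < q) ((fun y => F y i k) * (fun y => H y k j)).
Proof. by apply/funext => y; rewrite fct_sumE mxE. Qed.

Lemma mx_differentiableM p q r (F : point -> 'M[R]_(p, q))
    (H : point -> 'M[R]_(q, r)) x :
  mx_differentiable F x -> mx_differentiable H x ->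
  mx_differentiable (fun y => F y *m H y) x.
Proof.
move=> dF dH i j; rewrite fun_mulmxE.
by apply: differentiable_sum => k; exact: differentiableM.
Qed.

Lemma mx_differentiable_tr p q (F : point -> 'M[R]_(p, q)) x :
  mx_differentiable F x -> mx_differentiable (fun y => (F y)^T) x.
Proof. by move=> dF i j; under eq_fun do rewrite mxE. Qed.

Lemma mx_partialM p q r (F : point -> 'M[R]_(p, q)) (H : point -> 'M[R]_(q, r)) k x :
  mx_differentiable F x -> mx_differentiable H x ->
  mx_partial k (fun y => F y *m H y) x
  = mx_partial k F x *m H x + F x *m mx_partial k H x.
Proof.
move=> dF dH; apply/matrixP => i j; rewrite addmxE !mxE fun_mulmxE.
rewrite /partial derive_sum => [|l]; last first.
  by apply: diff_derivable; exact: differentiableM.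
rewrite -big_split; apply: eq_bigr => l _ /=.
rewrite !mxE; exact: partialM.
Qed.

Lemma mx_partial_tr p q k (F : point -> 'M[R]_(p, q)) x :
  mx_partial k (fun y => (F y)^T) x = (mx_partial k F x)^T.
Proof. by apply/matrixP => i j; rewrite !mxE; under eq_fun do rewrite mxE. Qed.

Lemma differentiable_row m (F : point -> 'rV[R]_m) x :
  (forall k, differentiable (fun y => F y 0 k) x) -> differentiable F x.
Proof.
move=> dF; have -> : F = \sum_(k < m) (fun y => F y 0 k *: (delta_mx 0 k : 'rV[R]_m)).
  by apply/funext => y; rewrite fct_sumE [LHS]row_sum_delta.
by apply: differentiable_sum => k; exact: differentiableZl.
Qed.

Lemma diffE_partial m (F : point -> 'rV[R]_m) x u :
  differentiable F x ->
  'd F x u = u *m \matrix_(i, a) partial i (fun y => F y 0 a) x.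
Proof.
move=> dF; rewrite -[LHS]mul_rV_lin1; congr (_ *m _).
apply/matrixP => i a; rewrite !mxE -deriveE // derive_mx; last first.
  exact: diff_derivable.
by rewrite mxE.
Qed.

Lemma partial_comp (f : point -> R) (F : point -> point) x k :
  differentiable F x -> differentiable f (F x) ->
  partial k (f \o F) x
  = \sum_c partial k (fun y => F y 0 c) x * partial c f (F x).
Proof.
move=> dF df; rewrite /partial deriveE; last exact: differentiable_comp.
rewrite diff_comp //= diffE_partial // -rowE [X in 'd f _ X]row_sum_delta.
rewrite linear_sum; apply: eq_bigr => c _ /=.
by rewrite linearZ /= -deriveE // !mxE.
Qed.

Lemma eq_near_mx_partial p q k (F H : point -> 'M[R]_(p, q)) (U : set point) x :
  open U -> U x -> {in U, F =1 H} -> mx_partial k F x = mx_partial k H x.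
Proof.
move=> oU Ux FH; apply/matrixP => i j; rewrite !mxE.
by apply: (eq_on_partial oU) => // y Uy; rewrite FH.
Qed.

Lemma mx_partial_comp p q k (H : point -> 'M[R]_(p, q)) (F : point -> point) x :
  differentiable F x -> mx_differentiable H (F x) ->
  mx_partial k (fun y => H (F y)) x
  = \sum_c partial k (fun y => F y 0 c) x *: mx_partial c H (F x).
Proof.
move=> dF dH; apply/matrixP => i j; rewrite summxE mxE.
rewrite -[X in partial k X]/((fun y => H y i j) \o F) partial_comp //.
by apply: eq_bigr => c _; rewrite !mxE.
Qed.

End MatrixPartial.

Section ChangeOfCharts.
Context {R : realType} {n : nat} {M : smoothManifold R n}.
Variables (g : riemannianMetric M) (V : vectorField M).
Variables c c' : chart R n M.
Hypotheses (Ac : atlas c) (Ac' : atlas c').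

Let D := transition_dom c c'.
Let phi := transition c c'.

Lemma transition_domP y : D y ->
  [/\ chart_cod c y, chart_cod c' (phi y) & chart_dom c' (chart_inv c y)].
Proof.
move=> [q [cq c'q] <-]; rewrite /phi /transition chart_mapK //.
by split=> //; exists q.
Qed.

Lemma transition_dom_open : open D.
Proof.
have -> : D = chart_cod c `&` (chart_inv c @^-1` chart_dom c').
  apply/seteqP; split=> [y Dy|y [[q cq <-]]].
    by have [] := transition_domP Dy.
  by rewrite /= chart_mapK // => c'q; exists q.
have oU : open (chart_cod c) by exact: chart_cod_open.
have cinv := @chart_inv_continuous _ _ _ c.
rewrite openE => y [Uy c'y]; apply: filterI; first exact: open_nbhs_nbhs.
rewrite continuous_open_subspace // in cinv.
apply: (cinv y); first by rewrite inE.
by apply: open_nbhs_nbhs; split=> //; exact: chart_dom_open.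
Qed.

Definition jac (y : 'rV[R]_n) : 'M[R]_n :=
  \matrix_(i, a) partial i (fun z => phi z 0 a) y.

Lemma transition_smooth a : smooth_on D (fun z => phi z 0 a).
Proof. exact: atlas_smooth. Qed.

Lemma transition_differentiable y : D y -> differentiable phi y.
Proof.
by move=> Dy; apply: differentiable_row => a; exact: (transition_smooth a [::]).
Qed.

Lemma jac_entry i a : (fun y => jac y i a) = partial i (fun z => phi z 0 a).
Proof. by apply/funext => y; rewrite mxE. Qed.

Lemma jac_differentiable y : D y -> mx_differentiable jac y.
Proof.
move=> Dy i a; rewrite jac_entry.
exact: (@transition_smooth a [:: i] y Dy).
Qed.

Lemma metric_jac y : D y -> g c y = jac y *m g c' (phi y) *m (jac y)^T.
Proof.
move=> Dy; apply/matrixP => i j.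
have := metric_compat g Ac Ac' Dy (delta_mx 0 i) (delta_mx 0 j).
rewrite !(diffE_partial _ (transition_differentiable Dy)) -/(jac y) trmx_mul.
move/matrixP/(_ 0 0); rewrite !mulmxA -(mulmxA _ (jac y)) -!mulmxA.
rewrite !trmx_delta !mulmxA -!rowE -!colE.
by rewrite -!row_mul ![col _ _ _ _]mxE ![row _ _ _ _]mxE.
Qed.

Lemma vf_jac y : D y -> V c' (phi y) = V c y *m jac y.
Proof.
move=> Dy; rewrite (vf_compat V Ac Ac' Dy).
exact: diffE_partial (transition_differentiable Dy).
Qed.

Lemma lie_metricE (b : chart R n M) x : lie_metric g V b x =
  \sum_k V b x 0 k *: mx_partial k (g b) x
  + (\matrix_(i, k) partial i (fun y => V b y 0 k) x) *m g b x
  + g b x *m (\matrix_(i, k) partial i (fun y => V b y 0 k) x)^T.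
Proof.
apply/matrixP => i j; rewrite !addmxE summxE !mxE -!big_split /=.
by apply: eq_bigr => k _; rewrite !mxE [g b x k j * _]mulrC.
Qed.

Lemma lie_metric_jac x : D x ->
  lie_metric g V c x = jac x *m lie_metric g V c' (phi x) *m (jac x)^T.
Proof.
move=> Dx; have [Ux U'x _] := transition_domP Dx.
have dJ := jac_differentiable Dx; have dphi := transition_differentiable Dx.
have dg' : mx_differentiable (g c') (phi x).
  by move=> i j; exact: (metric_smooth g Ac' i j [::] U'x).
have dG' : mx_differentiable (fun y => g c' (phi y)) x.
  move=> i j.
  exact: (@differentiable_comp _ _ _ _ phi (fun z => g c' z i j) x dphi (dg' i j)).
have dV : mx_differentiable (V c) x.
  by move=> i j; rewrite (ord1 i); exact: (vf_smooth V Ac j [::] Ux).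
have dV' : mx_differentiable (V c') (phi x).
  by move=> i j; rewrite (ord1 i); exact: (vf_smooth V Ac' j [::] U'x).
pose A := \matrix_(i, k) partial i (fun y => V c y 0 k) x.
pose A' := \matrix_(i, k) partial i (fun y => V c' y 0 k) (phi x).
pose DJ := \sum_k V c x 0 k *: mx_partial k jac x.
pose D' := \sum_k V c' (phi x) 0 k *: mx_partial k (g c') (phi x).
have E1 : \sum_k V c x 0 k *: mx_partial k (g c) x
   = DJ *m g c' (phi x) *m (jac x)^T + jac x *m D' *m (jac x)^T
     + jac x *m g c' (phi x) *m DJ^T.
  have E k : mx_partial k (g c) x =
      mx_partial k jac x *m g c' (phi x) *m (jac x)^T
      + jac x *m (\sum_l jac x k l *: mx_partial l (g c') (phi x)) *m (jac x)^T
      + jac x *m g c' (phi x) *m (mx_partial k jac x)^T.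
    rewrite (@eq_near_mx_partial _ _ _ _ k _
      (fun y => jac y *m g c' (phi y) *m (jac y)^T) D _ transition_dom_open Dx).
      rewrite mx_partialM; last 2 first.
      - exact: mx_differentiableM.
      - exact: mx_differentiable_tr.
      rewrite mx_partialM // mx_partial_tr mx_partial_comp // mulmxDl.
      congr (_ + _ *m _ *m _ + _); apply: eq_bigr => l _; by rewrite mxE.
    by move=> y /[!inE] Dy; exact: metric_jac.
  under eq_bigr do rewrite E !scalerDr.
  rewrite !big_split /=; congr (_ + _ + _).
  - by rewrite !mulmx_suml; apply: eq_bigr => k _; rewrite -!scalemxAl.
  - transitivity (jac x *m (\sum_k V c x 0 k *:
        (\sum_l jac x k l *: mx_partial l (g c') (phi x))) *m (jac x)^T).
      rewrite mulmx_sumr mulmx_suml; apply: eq_bigr => k _.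
      by rewrite -scalemxAr -scalemxAl.
    congr (_ *m _ *m _); rewrite /D' vf_jac //.
    under eq_bigr do rewrite scaler_sumr.
    rewrite exchange_big /=; apply: eq_bigr => l _; rewrite mxE scaler_suml.
    by apply: eq_bigr => k _; rewrite scalerA.
  - rewrite linear_sum mulmx_sumr; apply: eq_bigr => k _ /=.
    by rewrite linearZ -scalemxAr.
have E2 : jac x *m A' = A *m jac x + DJ.
  apply/row_matrixP => i; rewrite row_mul linearD /= row_mul.
  have rA : row i A = mx_partial i (V c) x.
    by apply/rowP => k; rewrite !mxE.
  have rDJ : row i DJ = V c x *m mx_partial i jac x.
    apply/rowP => a; rewrite mxE summxE [RHS]mxE; apply: eq_bigr => k _.
    rewrite [LHS]mxE; congr (_ * _); rewrite [LHS]mxE [RHS]mxE !jac_entry.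
    exact: (partialC transition_dom_open k i (transition_smooth a) Dx).
  rewrite rA rDJ -mx_partialM //.
  rewrite (@eq_near_mx_partial _ _ _ _ i _ (fun y => V c' (phi y)) D _
    transition_dom_open Dx); last first.
    by move=> y /[!inE] Dy; rewrite vf_jac.
  rewrite mx_partial_comp //; apply/rowP => a; rewrite summxE !mxE.
  by apply: eq_bigr => k _; rewrite !mxE.
rewrite !lie_metricE -/A -/A' -/D' E1 (metric_jac Dx).
have E3 : A'^T *m (jac x)^T = (jac x)^T *m A^T + DJ^T.
  by rewrite -trmx_mul E2 trmxD trmx_mul.
rewrite !mulmxDr !mulmxDl -!mulmxA E3 !mulmxA E2.
by mx_noncomm_ring.
Qed.

Lemma energy_jac x : D x ->
  V c' (phi x) *m g c' (phi x) *m (V c' (phi x))^T = V c x *m g c x *m (V c x)^T.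
Proof.
by move=> Dx; rewrite vf_jac // (metric_jac Dx) trmx_mul !mulmxA.
Qed.

Variable lambda : R.
Hypothesis soliton : forall b x, atlas b -> chart_cod b x ->
  2^-1 *: lie_metric g V b x + ricci g b x = (lambda / 2) *: g b x.

Lemma ricci_jac x : D x ->
  ricci g c x = jac x *m ricci g c' (phi x) *m (jac x)^T.
Proof.
move=> Dx; have [Ux U'x _] := transition_domP Dx.
have Ric_sub b y : atlas b -> chart_cod b y ->
    ricci g b y = (lambda / 2) *: g b y - 2^-1 *: lie_metric g V b y.
  by move=> Ab Uy; rewrite -soliton // addrC addKr.
rewrite !Ric_sub // lie_metric_jac // (metric_jac Dx).
by rewrite mulmxBr mulmxBl -!scalemxAr -!scalemxAl.
Qed.

Lemma scalar_jac x : D x ->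
  \sum_i \sum_j metric_inv g c x i j * ricci g c x i j
  = \sum_i \sum_j metric_inv g c' (phi x) i j * ricci g c' (phi x) i j.
Proof.
move=> Dx; have [Ux U'x _] := transition_domP Dx.
have trE b y : atlas b -> chart_cod b y ->
    \sum_i \sum_j metric_inv g b y i j * ricci g b y i j
    = \tr (metric_inv g b y *m ricci g b y).
  move=> Ab Uy; rewrite /mxtrace exchange_big; apply: eq_bigr => i _ /=.
  rewrite [RHS]mxE; apply: eq_bigr => j _.
  by rewrite (metric_inv_sym g Ab _ _ Uy).
rewrite (trE _ _ Ac Ux) (trE _ _ Ac' U'x) (ricci_jac Dx).
set J := jac x; set H := metric_inv g c x; set g' := g c' (phi x).
move: (ricci g c' (phi x)) => Rc.
rewrite !mulmxA mxtrace_mulC !mulmxA; congr (\tr (_ *m _)).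
have gE : g c x = J *m g' *m J^T := metric_jac Dx.
have gH : g c x *m H = 1%:M by rewrite mulmxV // metric_unit.
have J_unit : J \in unitmx.
  have := metric_unit g Ac Ux; rewrite gE !unitmx_mul.
  by move=> /andP[/andP[]].
have g'_unit : g' \in unitmx by exact: metric_unit.
have e : g' *m (J^T *m H *m J) = 1%:M.
  have JgJ : J *m (g' *m (J^T *m H *m J)) = J by rewrite !mulmxA -gE gH mul1mx.
  by rewrite -[LHS](mulKmx J_unit) JgJ mulVmx.
by rewrite -[LHS](mulKmx g'_unit) e mulmx1.
Qed.

End ChangeOfCharts.

Lemma chart_atP {R : realType} {n : nat} {M : smoothManifold R n} (p : M) :
  atlas (chart_at p) /\ chart_dom (chart_at p) p.
Proof. by rewrite /chart_at; case: cid2. Qed.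

Theorem corollary1 (R : realType) (n : nat) (M : smoothManifold R n)
    (g : riemannianMetric M) (V : vectorField M) (lambda : R) :
  ricci_soliton g V lambda ->
  let S : M -> R := scalar_curvature g in
  let E : M -> R := energy g V in
  forall p : M,
    divergence g
      (gradient g S + gradient g E + nabla g V V - lambda *: (V : components)) p
    = 0.
Proof.
move=> [_ _ soliton] S E p; have [Ac cp] := chart_atP p.
set c := chart_at p in Ac cp *.
have overlap y : chart_cod c y -> exists2 q, chart_inv c y = q &
    transition_dom (chart_at q) c (chart_at q q)
    /\ transition (chart_at q) c (chart_at q q) = y.
  move=> [q cq <-]; exists q; first by rewrite chart_mapK.
  have [Aq qq] := chart_atP q; rewrite /transition chart_mapK //.
  by split=> //; exists q.
apply: (@chart_divergence R n M g V lambda c Ac _ S E).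
- by move=> x; exact: soliton.
- move=> y /overlap[q -> [Dq <-]]; have [Aq _] := chart_atP q.
  exact: (scalar_jac Aq Ac soliton Dq).
- move=> y /overlap[q -> [Dq <-]]; have [Aq _] := chart_atP q.
  by rewrite (energy_jac g V Aq Ac Dq).
- by exists p.
Qed.
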